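(* Let $G\leqslant\mathrm{Sym}(\Omega)$ be a finite transitive permutation group. Let $R$ be a semiregular subset of $G$, and let $S$ be a maximum intersecting subset of $G$. Then (1) $|R||S|\leqslant |G|$, and $G=RS$ if $|R||S|=|G|$; (2) $\rho(G/\Omega)\leqslant \sqrt{|\Omega|}/|R|$; (3) in particular, if $R$ is a regular subset, then $G$ has the EKR property.
   Context: A subset $S\subseteq G$ is an intersecting subset if for all $x,y\in S$ the permutation $xy^{-1}$ fixes some point of $\Omega$; it is maximum if it has the largest possible size among intersecting subsets of $G$. A subset $R\subseteq G$ containing the identity is a semiregular subset if for any two distinct $r,s\in R$ the permutation $rs^{-1}$ fixes no point of $\Omega$; a semiregular subset is regular if $|R|=|\Omega|$. $G$ has the EKR property if its point stabilizers $G_\omega$ are maximum intersecting subsets. $RS=\{rs\mid r\in R,s\in S\}$. Define $\rho(G/\Omega)=\dfrac{|S|}{|G_\omega|\sqrt{|\Omega|}}$, where $S$ is a maximum intersecting subset and $\omega\in\Omega$. *)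

(* Defs.v *)
From mathcomp Require Import all_boot all_order all_algebra all_fingroup.

Set Implicit Arguments.
Unset Strict Implicit.
Unset Printing Implicit Defensive.

Import GRing.Theory Num.Theory.

(* Products of permutations compose from left to right, [(x * y) w = y (x w)],
   so [x * y^-1] fixes [w] iff [x w = y w]. *)

Section IntersectingSubsets.

Variables (T : finType) (G : {group {perm T}}).
Implicit Types R S : {set {perm T}}.

Definition intersecting S : bool :=
  (S \subset G) &&
  [forall x in S, forall y in S, exists w : T, (x * y^-1)%g w == w].

Definition maximum_intersecting S : bool :=
  intersecting S &&
  [forall S' : {set {perm T}}, intersecting S' ==> (#|S'| <= #|S|)].

Definition semiregular_subset R : bool :=
  [&& R \subset G, 1%g \in R &
      [forall r in R, forall s in R,
         (r != s) ==> [forall w : T, (r * s^-1)%g w != w]]].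

Definition regular_subset R : bool :=
  semiregular_subset R && (#|R| == #|T|).

Definition EKR : Prop :=
  forall w : T, maximum_intersecting 'C_G[w | 'P]%g.

(* The numerator is the common size of all maximum intersecting subsets. For
   transitive [G], all point stabilizers have the same order, so the value does
   not depend on [w]. *)
Definition rho (K : rcfType) (w : T) : K :=
  ((\max_(S : {set {perm T}} | intersecting S) #|S|)%:R /
   (#|'C_G[w | 'P]%g|%:R * Num.sqrt (#|T|%:R : K)))%R.

End IntersectingSubsets.

(* Main.v *)
Require Import Defs.
From mathcomp Require Import all_boot all_order all_algebra all_fingroup.

(** The multiplication map from [R x S] to [G] is injective. Indeed, if
    [r * s = r' * s'] then [r'^-1 * r = s' * s^-1] fixes a point because [S] is
    intersecting; its conjugate [r * r'^-1] then fixes a point too, which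
    semiregularity allows only when [r = r'], and so [s = s']. Hence
    [#|R| * #|S|] is the order of the subset [R * S] of [G]
    ([card_semiregular_mul_intersecting]), which gives the bound and the case of
    equality.

    The other two claims come from the bound and the orbit-stabilizer theorem
    [#|G| = #|G_w| * #|T|]: dividing by [#|R| * #|G_w| * sqrt #|T|] bounds [rho],
    and when [#|R| = #|T|] the bound says that no intersecting subset is larger
    than [G_w], which is itself intersecting. *)

Import GRing.Theory Num.Theory.

Section ProductBound.

Variables (T : finType) (G : {group {perm T}}).
Implicit Types R S : {set {perm T}}.

(** Intersecting subsets constrain [x * y^-1], whereas cancelling in a product
    with left factors [r], [r'] produces [r'^-1 * r]; conjugation by [r'^-1]
    passes from one form to the other. *)
Lemma fix_mulVg_mulgV (r r' : {perm T}) (w : T) :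
  (r'^-1 * r)%g w = w -> (r * r'^-1)%g (r'^-1%g w) = r'^-1%g w.
Proof. by rewrite !permM => ->. Qed.

Lemma card_semiregular_mul_intersecting R S :
  semiregular_subset G R -> intersecting G S ->
  #|(R * S)%g| = #|R| * #|S|.
Proof.
case/and3P=> _ _ /forall_inP semiR /andP[_ /forall_inP intS].
rewrite -cardsX [(R * S)%g]curry_imset2X card_in_imset //.
case=> r s [r' s'] /setXP[/= Rr Ss] /setXP[/= Rr' Ss'] /= eq_rs.
have [w fix_w] : exists w, (r'^-1 * r)%g w = w.
  have /forall_inP/(_ s Ss)/existsP[w /eqP fix_w] := intS s' Ss'.
  by exists w; rewrite -[r](mulgK s) eq_rs -mulgA mulKg.
have eq_r : r = r'.
  apply/eqP/contraT => neq_r.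
  have /forall_inP/(_ r' Rr') := semiR r Rr.
  rewrite neq_r => /forallP/(_ (r'^-1%g w)).
  by rewrite (fix_mulVg_mulgV _ _ _ fix_w) eqxx.
by move: eq_rs; rewrite eq_r => /mulgI ->.
Qed.

Lemma semiregular_mul_intersecting_sub R S :
  semiregular_subset G R -> intersecting G S -> (R * S)%g \subset G.
Proof. by case/and3P=> sRG _ _ /andP[sSG _]; rewrite mul_subG. Qed.

Lemma leq_semiregular_intersecting R S :
  semiregular_subset G R -> intersecting G S -> #|R| * #|S| <= #|G|.
Proof.
move=> semiR intS; rewrite -card_semiregular_mul_intersecting //.
exact/subset_leq_card/semiregular_mul_intersecting_sub.
Qed.

Lemma stabilizer_intersecting (w : T) : intersecting G 'C_G[w | 'P]%g.
Proof.
rewrite /intersecting subsetIl; apply/forall_inP=> x Cx.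
apply/forall_inP=> y Cy; apply/existsP; exists w.
have /setIP[_ /astab1P fix_w] : (x * y^-1)%g \in 'C_G[w | 'P]%g.
  by rewrite groupM ?groupV.
by apply/eqP.
Qed.

Lemma card_transitive_stabilizer (w : T) :
  [transitive G, on [set: T] | 'P]%g -> #|G| = #|'C_G[w | 'P]%g| * #|T|.
Proof.
move=> trG; rewrite -(card_orbit_in_stab 'P%act w (subsetT G)) mulnC.
by rewrite (atransP trG w (in_setT w)) cardsT.
Qed.

Lemma rho_le (K : rcfType) R (w : T) :
  [transitive G, on [set: T] | 'P]%g -> semiregular_subset G R ->
  (rho G K w <= Num.sqrt (#|T|%:R : K) / #|R|%:R)%R.
Proof.
move=> trG semiR; rewrite /rho.
have T_gt0 : (0 < #|T|%:R :> K)%R by rewrite ltr0n; apply/card_gt0P; exists w.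
have R_gt0 : (0 < #|R|%:R :> K)%R.
  by rewrite ltr0n; apply/card_gt0P; exists 1%g; case/and3P: semiR.
have C_gt0 : (0 < #|'C_G[w | 'P]%g|%:R :> K)%R by rewrite ltr0n cardG_gt0.
rewrite ler_pdivrMr ?mulr_gt0 ?sqrtr_gt0 // mulrAC ler_pdivlMr //.
rewrite mulrCA -expr2 sqr_sqrtr ?ltW // -!natrM ler_nat.
rewrite -card_transitive_stabilizer // mulnC.
have [|S intS ->] := @eq_bigmax_cond _ (intersecting G) (fun S => #|S|).
  by apply/card_gt0P; exists 'C_G[w | 'P]%g; apply: stabilizer_intersecting.
exact: leq_semiregular_intersecting.
Qed.

Lemma regular_subset_EKR R :
  [transitive G, on [set: T] | 'P]%g -> regular_subset G R -> EKR G.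
Proof.
move=> trG /andP[semiR /eqP cardR] w; apply/andP; split.
  exact: stabilizer_intersecting.
apply/forall_inP=> S intS.
have T_gt0 : 0 < #|T| by apply/card_gt0P; exists w.
rewrite -(leq_pmul2r T_gt0) -card_transitive_stabilizer // -cardR mulnC.
exact: leq_semiregular_intersecting.
Qed.

End ProductBound.

Theorem proposition1p1 (T : finType) (G : {group {perm T}})
    (R S : {set {perm T}}) :
  [transitive G, on [set: T] | 'P]%g ->
  semiregular_subset G R ->
  maximum_intersecting G S ->
  [/\ #|R| * #|S| <= #|G|
        /\ (#|R| * #|S| = #|G| -> G = (R * S)%g :> {set {perm T}}),
      forall (K : rcfType) (w : T),
        (rho G K w <= Num.sqrt (#|T|%:R : K) / #|R|%:R)%R
    & regular_subset G R -> EKR G].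
Proof.
move=> trG semiR /andP[intS _]; split=> [||]; last 2 first.
- by move=> K w; apply: rho_le.
- exact: regular_subset_EKR.
split=> [|eqG]; first exact: leq_semiregular_intersecting.
apply/esym/eqP; rewrite eqEcard semiregular_mul_intersecting_sub //.
by rewrite (card_semiregular_mul_intersecting _ _ _ _ semiR intS) eqG leqnn.
Qed.
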